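(* The series $\widetilde H_{a_1,\dots,a_r}(z)$ and $\Psi(z)\widetilde H_{a_1,\dots,a_r}(z)$, where $r\ge1$ and $(a_1,\dots,a_r)$ ranges over (pairwise distinct) tuples of positive integers none of which is divisible by $3$, together with the series $1$, are linearly independent over $(\mathbb Z/3\mathbb Z)[z]$, and consequently also over $(\mathbb Z/3^\gamma\mathbb Z)[z]$ for every positive integer $\gamma$, and over $\mathbb Z[z]$.
   Context: $\Psi(z)=\prod_{j\ge0}\bigl(1+z^{3^j}\bigr)$. For positive integers $a_1,\dots,a_r$, $$\widetilde H_{a_1,\dots,a_r}(z)=\sum_{k_1>\dots>k_r\ge0}\prod_{j=1}^{r}\left(\frac{z^{3^{k_j}}(1+z^{3^{k_j}})}{1+z^{3^{k_j+1}}}\right)^{a_j},$$ a formal power series in $z$ with integer coefficients (rational functions expanded as power series in $z$); $\widetilde H_{\emptyset}=1$. *)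

(* Defs.v *)
From HB Require Import structures.
From mathcomp Require Import all_boot all_order all_algebra.
Set Implicit Arguments. Unset Strict Implicit. Unset Printing Implicit Defensive.
Import Order.TTheory GRing.Theory Num.Theory.
Local Open Scope ring_scope.

Definition series := nat -> int.

Definition smul (f g : series) : series :=
  fun n => \sum_(i < n.+1) f i * g (n - i)%N.
Definition sadd (f g : series) : series := fun n => f n + g n.
Definition sone : series := fun n => (n == 0%N)%:R.
Definition sX (m : nat) : series := fun n => (n == m)%:R.
Definition sexp (f : series) (a : nat) : series := iter a (smul f) sone.

(* power series expansion of 1/(1 + z^m), m > 0 *)
Definition inv1pX (m : nat) : series :=
  fun n => if (m %| n)%N then (-1) ^+ (n %/ m) else 0.

Definition fk (k : nat) : series :=
  smul (sadd (sX (3 ^ k)) (sX (2 * 3 ^ k))) (inv1pX (3 ^ k.+1)).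

(* Gt s K = sum over K > k_1 > ... > k_r >= 0 of prod_j f_{k_j}^{a_j},
   where s = [:: a_1; ...; a_r]  (a finite sum). *)
Fixpoint Gt (s : seq nat) (K : nat) : series :=
  match s with
  | [::] => sone
  | a :: s' => fun n => \sum_(k < K) smul (sexp (fk k) a) (Gt s' k) n
  end.

(* \widetilde H_{a_1,...,a_r}.  Since every a_j >= 1, the term indexed by
   k_1 > ... > k_r has z-adic valuation >= 3^{k_1} > k_1, so the coefficient
   of z^n only receives contributions from k_1 <= n: it equals the
   coefficient of z^n in Gt s n.+1.  For s = [::] this is the series 1. *)
Definition Htil (s : seq nat) : series := fun n => Gt s n.+1 n.

(* Psi(z) = prod_{j >= 0} (1 + z^{3^j}); coefficient of z^n only depends
   on the factors with 3^j <= n, in particular j <= n. *)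
Definition Psi : series :=
  fun n => (\big[smul/sone]_(j < n.+1) sadd sone (sX (3 ^ j))) n.

(* Indices of the family: (s, false) |-> Htil s, (s, true) |-> Psi * Htil s.
   Admissible: all entries positive and not divisible by 3; the index
   ([::], false) is the series 1, and ([::], true) is excluded (r >= 1). *)
Definition admissible (i : seq nat * bool) : bool :=
  all (fun a => (0 < a)%N && ~~ (3 %| a)%N) i.1 && ((i.1 == [::]) ==> ~~ i.2).

Definition family (i : seq nat * bool) : series :=
  if i.2 then smul Psi (Htil i.1) else Htil i.1.

Definition lin_indep_over (R : comNzRingType) : Prop :=
  forall (I : seq (seq nat * bool)) (c : seq nat * bool -> {poly R}),
    uniq I -> all admissible I ->
    (forall n : nat,
        \sum_(i <- I) \sum_(k < n.+1) (c i)`_k * ((family i (n - k)%N)%:~R : R)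
        = 0) ->
    forall i, i \in I -> c i = 0.

(* Main.v *)
(* Modulo 3, Frobenius gives f_k = f^(3^k) with f = z/(1+z)^2, hence
     H_(s,a) = H_(s,a)^3 + f^a H_s^3,
   while Psi = (1+z)^(-1/2). So it suffices to show that the H_s are linearly
   independent over F_3[w], where w^2 = 1 + z and w^4 f = w^2 - 1. Let d be the
   coefficient of a longest word in a relation. Subtracting d^2 times the
   relation from its cube gives a relation without that word, which is trivial
   by induction. Hence the coefficients C of words of maximal length satisfy
   C^3 = d^2 C, that is C = eps d with eps in F_3, and the coefficient c of a
   word u one letter shorter satisfies
     c^3 - d^2 c = d^3 sum_a eps_a f^a.
   As f has a pole of order 4 at w = 0 and no a is divisible by 3, orders at
   w = 0 force all eps_a to vanish. Independence modulo 3^gamma and over Z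
   follows by dividing coefficients by 3 repeatedly. *)
Require Import Defs.
From HB Require Import structures.
From mathcomp Require Import all_boot all_order all_algebra.
From mathcomp Require Import boolp.
From mathcomp Require Import ring zify.
Set Implicit Arguments. Unset Strict Implicit. Unset Printing Implicit Defensive.
Import GRing.Theory.
Local Open Scope ring_scope.

(** * Formal power series *)

Definition fps (R : Type) : Type := nat -> R.

HB.instance Definition _ (R : Type) := gen_eqMixin (fps R).
HB.instance Definition _ (R : Type) := gen_choiceMixin (fps R).

Section FpsRing.
Variable R : comNzRingType.
Implicit Types f g h : fps R.

Definition fps_trunc n f : {poly R} := \poly_(i < n) f i.
Definition fps_of_poly (p : {poly R}) : fps R := fun n => p`_n.

Definition fps_add f g : fps R := fun n => f n + g n.
Definition fps_opp f : fps R := fun n => - f n.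
Definition fps_mul f g : fps R := fun n => \sum_(i < n.+1) f i * g (n - i)%N.

Lemma fps_addA : associative fps_add.
Proof. by move=> f g h; apply: funext => n; apply: addrA. Qed.
Lemma fps_addC : commutative fps_add.
Proof. by move=> f g; apply: funext => n; apply: addrC. Qed.
Lemma fps_add0 : left_id (fun=> 0) fps_add.
Proof. by move=> f; apply: funext => n; apply: add0r. Qed.
Lemma fps_addN : left_inverse (fun=> 0) fps_opp fps_add.
Proof. by move=> f; apply: funext => n; apply: addNr. Qed.

HB.instance Definition _ :=
  GRing.isZmodule.Build (fps R) fps_addA fps_addC fps_add0 fps_addN.

Lemma coef_fps_trunc n f i : (i < n)%N -> (fps_trunc n f)`_i = f i.
Proof. by move=> lt_in; rewrite coef_poly lt_in. Qed.

Lemma fps_mul_poly (p q : {poly R}) n f g :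
    (forall i, (i < n)%N -> p`_i = f i) -> (forall i, (i < n)%N -> q`_i = g i) ->
  forall i, (i < n)%N -> (p * q)`_i = fps_mul f g i.
Proof.
move=> pf qg i lt_in; rewrite coefM; apply: eq_bigr => j _.
by rewrite pf ?qg //; have := ltn_ord j; lia.
Qed.

(* Identities between products are checked on truncations, where they are
   identities between polynomials. *)
Let tr n f := @coef_fps_trunc n f.

Lemma fps_mulA : associative fps_mul.
Proof.
move=> f g h; apply: funext => n.
rewrite -(fps_mul_poly (@tr n.+1 f) (fps_mul_poly (@tr _ g) (@tr _ h))) //.
by rewrite -(fps_mul_poly (fps_mul_poly (@tr n.+1 f) (@tr _ g)) (@tr _ h)) // mulrA.
Qed.
Lemma fps_mulC : commutative fps_mul.
Proof.
move=> f g; apply: funext => n.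
by rewrite -(fps_mul_poly (@tr n.+1 f) (@tr _ g)) // mulrC (fps_mul_poly (@tr _ g) (@tr _ f)).
Qed.
Lemma fps_mul1 : left_id (fps_of_poly 1) fps_mul.
Proof.
move=> f; apply: funext => n.
by rewrite -(@fps_mul_poly 1 (fps_trunc n.+1 f) n.+1 _ _ _ (@tr _ f)) // mul1r tr.
Qed.
Lemma fps_mulDl : left_distributive fps_mul fps_add.
Proof.
move=> f g h; apply: funext => n; rewrite /fps_add /fps_mul -big_split /=.
by apply: eq_bigr => i _; rewrite mulrDl.
Qed.
Lemma fps_1neq0 : fps_of_poly 1 != 0.
Proof. by apply/eqP => /(congr1 (@^~ 0%N)); rewrite /fps_of_poly coef1 /=; apply/eqP/oner_neq0. Qed.

HB.instance Definition _ := GRing.Zmodule_isComNzRing.Build (fps R)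
  fps_mulA fps_mulC fps_mul1 fps_mulDl fps_1neq0.

Lemma fps_addE f g n : (f + g) n = f n + g n. Proof. by []. Qed.
Lemma fps_mulE f g n : (f * g) n = \sum_(i < n.+1) f i * g (n - i)%N.
Proof. by []. Qed.
Lemma fps_sumE I (r : seq I) (P : pred I) (F : I -> fps R) n :
  (\sum_(i <- r | P i) F i) n = \sum_(i <- r | P i) F i n.
Proof. exact: (big_morph (fun f : fps R => f n)). Qed.

Lemma fps_of_poly_zmod : zmod_morphism fps_of_poly.
Proof. by move=> p q; apply: funext => n; rewrite /fps_of_poly coefB. Qed.
Lemma fps_of_poly_monoid : monoid_morphism fps_of_poly.
Proof. by split=> // p q; apply: funext => n; apply: coefM. Qed.
HB.instance Definition _ :=
  GRing.isZmodMorphism.Build {poly R} (fps R) fps_of_poly fps_of_poly_zmod.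
HB.instance Definition _ :=
  GRing.isMonoidMorphism.Build {poly R} (fps R) fps_of_poly fps_of_poly_monoid.

Lemma fps_of_poly_inj : injective fps_of_poly.
Proof. by move=> p q epq; apply/polyP => i; apply: (congr1 (@^~ i) epq). Qed.

Definition fpsX : fps R := fps_of_poly 'X.

Lemma fpsXnE m n : (fpsX ^+ m) n = (n == m)%:R.
Proof.
have -> : fpsX ^+ m = fps_of_poly 'X^m by rewrite rmorphXn.
exact: coefXn.
Qed.

(** Congruence modulo z^n, by which infinite sums and products are compared with finite ones. *)
Definition fps_eqm n f g := forall i, (i < n)%N -> f i = g i.

Lemma fps_eqm_mul n f f' g g' :
  fps_eqm n f f' -> fps_eqm n g g' -> fps_eqm n (f * g) (f' * g').
Proof.
move=> ff gg i lt_in; rewrite !fps_mulE; apply: eq_bigr => j _.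
by rewrite ff ?gg //; have := ltn_ord j; lia.
Qed.
Lemma fps_eqm_exp n f g m : fps_eqm n f g -> fps_eqm n (f ^+ m) (g ^+ m).
Proof.
move=> fg; elim: m => [|m IHm]; first by rewrite !expr0.
by rewrite !exprS; apply: fps_eqm_mul.
Qed.

Lemma fps_mulXnE m f n :
  (fpsX ^+ m * f) n = if (m <= n)%N then f (n - m)%N else 0.
Proof.
case: leqP => [lt_mn|lt_nm]; rewrite fps_mulE.
  rewrite (bigD1 (Ordinal (lt_mn : (m < n.+1)%N))) //= fpsXnE eqxx mul1r.
  by rewrite big1 ?addr0 // => i; rewrite -val_eqE /= fpsXnE => /negbTE ->; rewrite mul0r.
by rewrite big1 // => i _; rewrite fpsXnE; case: eqP => [|_]; [have := ltn_ord i; lia | rewrite mul0r].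
Qed.

Lemma fps_mulXn_lt m f n : (n < m)%N -> (fpsX ^+ m * f) n = 0.
Proof. by rewrite ltnNge => /negbTE lt_nm; rewrite fps_mulXnE lt_nm. Qed.

End FpsRing.

(** * Orders at zero of polynomials *)

Section Valuation.
Variable F : fieldType.
Implicit Types p q r c d : {poly F}.

Lemma polyX_split p : p != 0 -> exists k q, ~~ root q 0 /\ p = 'X^k * q.
Proof.
move=> p_neq0; have [k [q]] := multiplicity_XsubC p 0.
by rewrite p_neq0 subr0 mulrC => ? ->; exists k, q.
Qed.

Lemma polyX_split_lt k l p q : (k < l)%N -> ~~ root p 0 -> 'X^k * p != 'X^l * q.
Proof.
move=> lt_kl; apply: contra => /eqP.
rewrite -(subnKC (ltnW lt_kl)) exprD -mulrA.
move/(mulfI (monic_neq0 (monicXn _ _))) => ->.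
by rewrite rootM rootE hornerXn expr0n subn_eq0 leqNgt lt_kl eqxx.
Qed.

Lemma polyX_split_inj k l p q :
  ~~ root p 0 -> ~~ root q 0 -> 'X^k * p = 'X^l * q -> k = l.
Proof.
move=> p0 q0 epq; case: (ltngtP k l) => // lt_kl.
  by have := polyX_split_lt q lt_kl p0; rewrite epq eqxx.
by have := polyX_split_lt p lt_kl q0; rewrite epq eqxx.
Qed.

(* The orders at 0 of both sides cannot agree: on the right it is 3 ord(d); on
   the left it is either at least 4a + 3 ord(d), or congruent to a modulo 3. *)
Lemma artin_schreier_pole a c d r :
    (0 < a)%N -> ~~ (3 %| a)%N -> d != 0 -> ~~ root r 0 ->
  'X^(4 * a) * (c ^+ 3 - d ^+ 2 * c) != d ^+ 3 * r.
Proof.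
move=> a_gt0 a3 d_neq0 r0; apply/eqP => eq_cd.
have r_neq0 : r != 0 by apply: contraNneq r0 => ->; rewrite root0.
have [c0|c_neq0] := eqVneq c 0.
  move/eqP: eq_cd; rewrite c0 expr0n mulr0 subr0 mulr0 eq_sym mulf_eq0.
  by rewrite expf_eq0 (negbTE d_neq0) (negbTE r_neq0).
have [i [c' [c'0 def_c]]] := polyX_split c_neq0.
have [j [d' [d'0 def_d]]] := polyX_split d_neq0.
have rootX p n : ~~ root p 0 -> ~~ root (p ^+ n) 0.
  by rewrite !rootE horner_exp => /expf_neq0.
have dr0 : ~~ root (d' ^+ 3 * r) 0 by rewrite rootM negb_or r0 rootX.
(* If ord(d) = j <= i = ord(c), the left side is divisible by X^(4a+3j), while the right side has
   order exactly 3j. *)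
have [le_ji|lt_ij] := leqP j i.
  have lt_j : (3 * j < 4 * a + 3 * j)%N by lia.
  case/eqP: (polyX_split_lt
    (('X^(i - j) * c') ^+ 3 - d' ^+ 2 * ('X^(i - j) * c')) lt_j dr0).
  move: eq_cd; rewrite def_c def_d -{1 2}(subnKC le_ji) !exprD.
  move: ('X^(i - j)) => Y eq_cd.
  transitivity (('X^j * d') ^+ 3 * r); first ring.
  by rewrite -eq_cd; ring.
(* If i < j, the cube of [c] dominates: [u], the left side without X^(4a+3i), does not vanish at 0.
   Equal orders would give a = 3(j - i - a). *)
set u := c' ^+ 3 - 'X^((j - i) + (j - i)) * d' ^+ 2 * c'.
have u0 : ~~ root u 0.
  rewrite rootE hornerD hornerN horner_exp !hornerM hornerXn.
  rewrite expr0n (_ : (_ + _ == _)%N = false); last lia.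
  by rewrite !mul0r subr0 expf_neq0.
suff /(polyX_split_inj u0 dr0) e : 'X^(4 * a + 3 * i) * u = 'X^(3 * j) * (d' ^+ 3 * r).
  by case/negP: a3; apply/dvdnP; exists (j - i - a)%N; lia.
move: eq_cd; rewrite def_c def_d /u -{1 2 5}(subnKC (ltnW lt_ij)) !exprD.
move: ('X^(j - i)) => Y eq_cd.
transitivity (('X^i * Y * d') ^+ 3 * r); last ring.
by rewrite -eq_cd; ring.
Qed.
End Valuation.

(** * Linear independence from the Frobenius equations *)

(** Both sides are 4(M - b). The right one isolates X^(4(M-a)), common to all words [b :: u] with b
    <= a; n is the letter sum of [u]. *)
Lemma exponent_split M a b n : (b <= a)%N -> (a <= M)%N -> (b + n <= M)%N ->
  (4 * (M - (b + n)) + 4 * n = 4 * (M - a) + 4 * (a - b))%N.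
Proof. lia. Qed.

Definition good_letter (a : nat) : bool := (0 < a)%N && ~~ (3 %| a)%N.

Section Independence.
(** In the application [e] evaluates the variable at w = (1 + z)^(1/2), so ['X^2 - 1] stands for z
    and [def_f] reads w^4 f = z. *)
Variables (F : fieldType) (R : comNzRingType) (e : {rmorphism {poly F} -> R}).
Variables (h : seq nat -> R) (f : R).
Hypothesis e_inj : injective e.
Hypothesis charR : 3%N \in [pchar R].
Hypothesis h_nil : h [::] = 1.
Hypothesis h_cons : forall a t, all good_letter (a :: t) ->
  h (a :: t) = h (a :: t) ^+ 3 + f ^+ a * h t ^+ 3.
Hypothesis def_f : e 'X^4 * f = e ('X^2 - 1).

Implicit Types (s t u : seq nat) (S : seq (seq nat)) (C : seq nat -> {poly F}).

(* X^(4 |s|) h(s)^3 is the sum of [cube_coef s t] h(t) over the suffixes t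
   of s, where |s| is the sum of the letters. *)
Fixpoint cube_coef s t : {poly F} :=
  if s is a :: s' then
    if t == s then 'X^(4 * sumn s) else - ('X^2 - 1) ^+ a * cube_coef s' t
  else (t == [::])%:R.

Lemma cube_coef_eq0 s t : (size s <= size t)%N -> s != t -> cube_coef s t = 0.
Proof.
elim: s t => [|a s IHs] t /= le_st; first by case: t le_st.
rewrite eq_sym => /negbTE ->; rewrite IHs ?mulr0 //; first exact: ltnW.
by apply: contraTneq le_st => ->; rewrite ltnn.
Qed.

Lemma cube_coef_id s : cube_coef s s = 'X^(4 * sumn s).
Proof. by case: s => [|a s] /=; rewrite ?eqxx ?muln0 ?expr0. Qed.

(** Only the tail of [a :: s] contributes one letter below the top; this yields the equation for the
    coefficient of [u] in [h_lin_indep]. *)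
Lemma cube_coef_cons a s t : size s = size t ->
  cube_coef (a :: s) t = if s == t then - ('X^2 - 1) ^+ a * 'X^(4 * sumn s) else 0.
Proof.
move=> eq_st /=; case: eqP => [et|_]; first by have := congr1 size et; rewrite /=; lia.
case: eqP => [->|/eqP neq_st]; first by rewrite cube_coef_id.
by rewrite cube_coef_eq0 ?eq_st ?mulr0.
Qed.

Definition suffix_closed S := forall a t, a :: t \in S -> t \in S.

(** By [h_cons], h(a :: t)^3 = h(a :: t) - f^a h(t)^3. The factor X^(4a) turns f^a into (X^2 - 1)^a,
    and induction expands h(t)^3. *)
Lemma cube_expansion S s :
    uniq S -> suffix_closed S -> all (all good_letter) S -> s \in S ->
  e 'X^(4 * sumn s) * h s ^+ 3 = \sum_(t <- S) e (cube_coef s t) * h t.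
Proof.
move=> uS clS goodS; elim: s => [|a s IHs] sS.
  rewrite (bigD1_seq [::]) //= h_nil muln0 expr0 rmorph1 !mul1r expr1n.
  by rewrite big1 ?addr0 // => t /negbTE ->; rewrite rmorph0 mul0r.
have {}IHs := IHs (clS _ _ sS).
rewrite (bigD1_seq (a :: s)) //= eqxx.
rewrite (bigD1_seq (a :: s)) //= cube_coef_eq0 // ?rmorph0 ?mul0r ?add0r in IHs; last first.
  by apply/eqP => es; have := congr1 size es; rewrite /=; lia.
rewrite [X in _ = _ + X](_ : _ = - e ('X^2 - 1) ^+ a * (e 'X^(4 * sumn s) * h s ^+ 3)).
  rewrite -def_f mulnDr exprD rmorphM exprM rmorphXn [in RHS]h_cons; last exact: (allP goodS).
  by rewrite exprMn rmorphXn; ring.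
rewrite IHs mulr_sumr; apply: eq_bigr => t /negbTE ->.
by rewrite rmorphM rmorphN rmorphXn mulrA.
Qed.

Lemma Frobenius_sum S C :
  (\sum_(s <- S) e (C s) * h s) ^+ 3 = \sum_(s <- S) e (C s) ^+ 3 * h s ^+ 3.
Proof.
elim: S => [|s S IHS]; first by rewrite !big_nil expr0n.
by rewrite !big_cons exprDn_pchar ?pnatE // IHS exprMn.
Qed.

(** Induction along a list sorted by length: dropping the last word, a longest one, keeps the list
    suffix-closed. *)
Lemma h_lin_indep S C :
    uniq S -> suffix_closed S -> all (all good_letter) S ->
    pairwise (fun s t => size s <= size t)%N S ->
    \sum_(s <- S) e (C s) * h s = 0 ->
  forall s, s \in S -> C s = 0.
Proof.
elim/last_ind: S C => [//|S s0 IHS] C uS clS goodS.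
rewrite pairwise_rcons => /andP[/allP/= le_s0 pwS] relC.
move: (uS); rewrite rcons_uniq => /andP[s0S uS'].
have max_s0 s : s \in rcons S s0 -> (size s <= size s0)%N.
  by rewrite mem_rcons inE => /predU1P[->|/le_s0].
have goodS' : all (all good_letter) S by move: goodS; rewrite all_rcons => /andP[].
have clS' : suffix_closed S.
  move=> a t atS; have := clS a t; rewrite !mem_rcons !inE atS orbT => /(_ isT).
  case/predU1P => // et; have := le_s0 _ atS; rewrite /= et; lia.
have IH C' : \sum_(s <- S) e (C' s) * h s = 0 -> forall s, s \in S -> C' s = 0.
  exact: IHS.
have [d0|d_neq0] := eqVneq (C s0) 0.
  move: relC; rewrite -cats1 big_cat big_seq1 /= d0 rmorph0 mul0r addr0 => /IH CS s.
  by rewrite mem_cat inE => /orP[/CS|/eqP ->].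
exfalso; set d := C s0 in d_neq0.
(* X^(4M) clears the denominators of all cubes; [D t] is the coefficient of h(t) in X^(4M) times the
   cubed relation minus d^2 times the relation. *)
pose M := (\sum_(s <- rcons S s0) sumn s)%N.
have le_M s : s \in rcons S s0 -> (sumn s <= M)%N.
  by move=> sS; rewrite /M (bigD1_seq s) //= leq_addr.
pose T s t := 'X^(4 * (M - sumn s)) * C s ^+ 3 * cube_coef s t.
pose D t := \sum_(s <- rcons S s0) T s t - d ^+ 2 * 'X^(4 * M) * C t.
have T_id t : t \in rcons S s0 -> T t t = 'X^(4 * M) * C t ^+ 3.
  move=> tS; rewrite /T cube_coef_id mulrAC -exprD -mulnDr subnK ?le_M //.
have D_top t : t \in rcons S s0 -> size t = size s0 ->
    D t = 'X^(4 * M) * (C t ^+ 3 - d ^+ 2 * C t).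
  move=> tS szt; rewrite /D (bigD1_seq t) //= T_id // big_seq_cond big1 ?addr0.
    by ring.
  by move=> s /andP[sS neq_st]; rewrite /T cube_coef_eq0 ?mulr0 // szt max_s0.
have relD : \sum_(t <- rcons S s0) e (D t) * h t = 0.
  transitivity (e 'X^(4 * M) * (\sum_(s <- rcons S s0) e (C s) * h s) ^+ 3
    - e (d ^+ 2 * 'X^(4 * M)) * \sum_(s <- rcons S s0) e (C s) * h s); last first.
    by rewrite relC expr0n !mulr0 subr0.
  rewrite Frobenius_sum !mulr_sumr.
  under eq_bigr do rewrite /D rmorphB mulrBl rmorph_sum mulr_suml.
  rewrite sumrB exchange_big /=; congr (_ - _); last first.
    by apply: eq_bigr => t _; rewrite rmorphM mulrA.
  apply: eq_big_seq => s sS.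
  rewrite -(subnK (le_M _ sS)) mulnDr exprD rmorphM -rmorphXn.
  transitivity (e ('X^(4 * (M - sumn s)) * C s ^+ 3) * (e 'X^(4 * sumn s) * h s ^+ 3)).
    rewrite (cube_expansion uS) // mulr_sumr; apply: eq_bigr => t _.
    by rewrite rmorphM mulrA.
  by rewrite rmorphM; ring.
(* At [s0] the factor d^3 - d^2 d vanishes, so the induction hypothesis applies to [D]. *)
have D0 t : t \in rcons S s0 -> D t = 0.
  have Ds0 : D s0 = 0.
    by rewrite D_top // ?mem_rcons ?mem_head // -/d; ring.
  move: relD; rewrite -cats1 big_cat big_seq1 /= Ds0 rmorph0 mul0r addr0 => /IH DS.
  by rewrite mem_cat inE => /orP[/DS|/eqP ->].
have s0_in : s0 \in rcons S s0 by rewrite mem_rcons mem_head.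
have C_top s : s \in rcons S s0 -> size s = size s0 ->
    C s = 0 \/ C s ^+ 3 = d ^+ 3 * (if C s == d then 1 else -1)%:P.
  move=> sS szs; have /eqP := D0 s sS; rewrite D_top // mulf_eq0.
  rewrite (negbTE (monic_neq0 (monicXn _ _))) /=.
  have -> : C s ^+ 3 - d ^+ 2 * C s = C s * ((C s - d) * (C s + d)) by ring.
  rewrite !mulf_eq0 subr_eq0 addr_eq0 => /or3P[/eqP ->|/eqP ->|/eqP ->]; first by left.
    by right; rewrite eqxx mulr1.
  right; case: eqP => [->|_]; first by rewrite mulr1.
  by rewrite polyCN; ring.
case def_s0: s0 => [|a0 u].
  have S_nil : S = [::].
    case: (S) le_s0 s0S => // s S1 /(_ _ (mem_head _ _)); rewrite def_s0.
    by case: s => //; rewrite mem_head.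
  move: relC; rewrite S_nil big_seq1 -/d def_s0 h_nil mulr1 -(rmorph0 e) => /e_inj.
  exact/eqP.
have uS0 : u \in rcons S s0 by apply: (clS a0); rewrite -def_s0.
have szu : size s0 = (size u).+1 by rewrite def_s0.
(* Such a [b] contributes a term eps_b f^b with a pole of order 4b at w = 0; the largest one, [a],
   decides. *)
pose pole b := (b :: u \in rcons S s0) && (C (b :: u) != 0).
have pole_ex : exists b, pole b.
  by exists a0; rewrite /pole -def_s0 s0_in.
have pole_bd b : pole b -> (b <= M)%N.
  by case/andP => bS _; exact: (leq_trans (leq_addr (sumn u) b) (le_M _ bS)).
case: (ex_maxnP pole_ex pole_bd) => a /andP[aS Ca] a_max {pole_ex}.
have le_aM : (a <= M)%N by exact: (leq_trans (leq_addr (sumn u) a) (le_M _ aS)).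
(* For a longest word, C(s)^3 = eps d^3. The polynomial [rho (b :: u)] is w^(4a) eps_b f^b, and [r]
   sums these terms. *)
pose eps s : F := if C s == 0 then 0 else if C s == d then 1 else -1.
pose rho s : {poly F} := if (s != [::]) && (behead s == u) then
  'X^(4 * (a - head 0%N s)) * (eps s)%:P * ('X^2 - 1) ^+ head 0%N s else 0.
pose r := \sum_(s <- rcons S s0 | s != u) rho s.
have T_rho s : s \in rcons S s0 -> s != u -> T s u = - ('X^(4 * (M - a)) * (d ^+ 3 * rho s)).
  move=> sS neq_su; rewrite /T /rho; case: s sS neq_su => [|b s] sS neq_su; rewrite [_ && _]/=.
    by rewrite cube_coef_eq0 // !mulr0 oppr0.
  have := max_s0 _ sS; rewrite szu [size _]/= ltnS leq_eqVlt => /orP[/eqP szs|lt_su]; last first.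
    rewrite cube_coef_eq0 //.
    rewrite ifN ?mulr0 ?oppr0 //.
    by apply/negP => /eqP es; move: lt_su; rewrite es ltnn.
  rewrite cube_coef_cons // [head _ _]/= [sumn _]/=.
  case: eqP => [es|]; last by rewrite !mulr0 oppr0.
  subst s; rewrite /eps.
  have sz_top : size (b :: u) = size s0 by rewrite szu.
  case: eqP => [->|/eqP Cb]; first by rewrite polyC0; ring.
  have le_ba : (b <= a)%N by apply: a_max; rewrite /pole sS.
  have [/eqP|->] := C_top _ sS sz_top; first by rewrite (negbTE Cb).
  have le_bM := le_M _ sS; rewrite /= in le_bM.
  have -> : 'X^(4 * (M - (b + sumn u))) * (d ^+ 3 * (if C (b :: u) == d then 1 else -1)%:P)
     * (- ('X^2 - 1) ^+ b * 'X^(4 * sumn u))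
   = - ('X^(4 * (M - (b + sumn u)) + 4 * sumn u) *
       (d ^+ 3 * ((if C (b :: u) == d then 1 else -1)%:P * ('X^2 - 1) ^+ b))) :> {poly F}.
    by rewrite exprD; ring.
  rewrite (exponent_split le_ba le_aM le_bM).
  by rewrite exprD; ring.
(* At w = 0 the terms with b < a vanish, which leaves eps_a (-1)^a. *)
have r0 : ~~ root r 0.
  have neq_au : a :: u != u by apply/eqP => /(congr1 size)/eqP; rewrite eqn_leq ltnn.
  rewrite rootE /r big_mkcond (bigD1_seq (a :: u)) //= neq_au hornerD.
  rewrite [X in _ + X](_ : _ = 0); last first.
    rewrite -/(horner_eval 0 _) rmorph_sum big_seq_cond big1 // => s /andP[sS neq_sa].
    case: ifP => [_|_]; last by rewrite rmorph0.
    rewrite /rho; case: ifP => [|_]; last by rewrite rmorph0.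
    case: s sS neq_sa => //= b s sS neq_ba /eqP es; subst s.
    rewrite /eps; case: eqP => [_|/eqP Cb]; first by rewrite polyC0 mulr0 mul0r rmorph0.
    have lt_ba : (b < a)%N.
      rewrite ltn_neqAle a_max ?andbT; last by rewrite /pole sS.
      by apply: contraNneq neq_ba => ->.
    by rewrite /horner_eval !hornerM hornerXn expr0n muln_eq0 subn_eq0 leqNgt lt_ba !mul0r.
  rewrite addr0 /rho /= eqxx subnn muln0 expr0 mul1r /eps (negbTE Ca).
  rewrite hornerM hornerC horner_exp hornerD hornerN hornerXn hornerC expr0n add0r.
  by rewrite mulf_neq0 ?expf_neq0 ?oppr_eq0 ?oner_neq0 //; case: ifP; rewrite ?oppr_eq0 oner_neq0.
have [a_gt0 a3] : (0 < a)%N /\ ~~ (3 %| a)%N.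
  by have := allP goodS _ aS => /= /andP[/andP[]].
(* Dividing D(u) = 0 by X^(4(M-a)) gives X^(4a) (c^3 - d^2 c) = d^3 r with c = C(u). *)
have := artin_schreier_pole (C u) a_gt0 a3 d_neq0 r0; case/negP; apply/eqP.
have := D0 u uS0; rewrite /D (bigD1_seq u) //= T_id //.
rewrite big_seq_cond (eq_bigr (fun s => - ('X^(4 * (M - a)) * (d ^+ 3 * rho s)))); last first.
  by move=> s /andP[]; apply: T_rho.
rewrite -big_seq_cond sumrN -!mulr_sumr -/r => /eqP.
rewrite -{1 3}(subnK le_aM) mulnDr exprD => eq0.
apply: (mulfI (monic_neq0 (monicXn _ (4 * (M - a))))).
by apply/eqP; rewrite -subr_eq0 -(eqP eq0); apply/eqP; ring.
Qed.
End Independence.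

(** * The series modulo 3 *)

Section Mod3.
Local Notation F := 'F_3.
Local Notation A := (fps F).
Local Notation X := (fpsX F).

Lemma pchar3_fps : 3%N \in [pchar A].
Proof. exact: (rmorph_pchar (@fps_of_poly F \o polyC) (pchar_Fp _)). Qed.

Lemma cubeD (x y : A) : (x + y) ^+ 3 = x ^+ 3 + y ^+ 3.
Proof. by rewrite exprDn_pchar // pnatE // pchar3_fps. Qed.

Lemma cube_sum I (r : seq I) (G : I -> A) :
  (\sum_(i <- r) G i) ^+ 3 = \sum_(i <- r) G i ^+ 3.
Proof. by apply: (big_morph (fun x : A => x ^+ 3)); [exact: cubeD | rewrite expr0n]. Qed.

Lemma expr_pow3D k (x y : A) : (x + y) ^+ (3 ^ k) = x ^+ (3 ^ k) + y ^+ (3 ^ k).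
Proof. by elim: k => [|k IHk]; rewrite ?expr1 // expnSr !exprM IHk cubeD. Qed.

Definition red (s : series) : A := fun n => (s n)%:~R.

Lemma red_mul f g : red (smul f g) = red f * red g.
Proof.
apply: funext => n; rewrite /red /smul rmorph_sum fps_mulE.
by apply: eq_bigr => i _; rewrite rmorphM.
Qed.
Lemma red_add f g : red (sadd f g) = red f + red g.
Proof. by apply: funext => n; rewrite /red /sadd rmorphD. Qed.
Lemma red_sX m : red (sX m) = X ^+ m.
Proof. by apply: funext => n; rewrite fpsXnE /red /sX; case: eqP. Qed.
Lemma red_one : red sone = 1.
Proof. exact: (red_sX 0). Qed.
Lemma red_sexp f a : red (sexp f a) = red f ^+ a.
Proof.
elim: a => [|a IHa]; first exact: red_one.
by rewrite exprS -IHa -red_mul.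
Qed.

Lemma red_inv1pX m : (0 < m)%N -> red (inv1pX m) * (1 + X ^+ m) = 1.
Proof.
move=> m_gt0; rewrite mulrC mulrDl mul1r; apply: funext => n.
rewrite -[1]/(X ^+ 0) fps_addE fps_mulXnE fpsXnE /red /inv1pX.
case: leqP => [le_mn|lt_nm]; last first.
  rewrite addr0; case: ifP => [/dvdnP[q def_n]|m'n].
    by move: lt_nm; rewrite def_n -[Y in (_ < Y)%N]mul1n ltn_pmul2r // ltnS leqn0 => /eqP ->; rewrite div0n.
  by case: eqP m'n => // ->; rewrite dvdn0.
rewrite (gtn_eqF (leq_trans m_gt0 le_mn)) dvdn_subl //.
case: ifP => [/dvdnP[q def_n]|_]; last by rewrite !mulr0z addr0.
move: le_mn; rewrite def_n -{1}[m]mul1n leq_pmul2r // => q_gt0.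
by case: q q_gt0 {def_n} => // q _; rewrite mulSnr addnK -mulSnr !mulnK // exprS mulN1r rmorphN addNr.
Qed.

Definition base : A := X * red (inv1pX 1) ^+ 2.

Lemma base_eq : base * (1 + X) ^+ 2 = X.
Proof.
by rewrite /base -mulrA -exprMn -{2}[X]expr1 red_inv1pX // expr1n mulr1.
Qed.

(** Modulo 3, raising to the power 3^k is additive, so the fraction is the 3^k-th power of z (1 + z)
    / (1 + z)^3. *)
Lemma red_fk k : red (fk k) = base ^+ (3 ^ k).
Proof.
have v1 : red (inv1pX 1) * (1 + X) = 1 by rewrite -{1}[X]expr1 red_inv1pX.
have def_inv : red (inv1pX (3 ^ k.+1)) = red (inv1pX 1) ^+ (3 ^ k.+1).
  have := red_inv1pX (_ : 0 < 3 ^ k.+1)%N; rewrite expn_gt0 => /(_ isT).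
  rewrite -[Y in Y + _](expr1n _ (3 ^ k.+1)) -expr_pow3D => inv1.
  rewrite -[LHS]mulr1 -(expr1n _ (3 ^ k.+1)) -v1 exprMn mulrCA inv1 mulr1 //.
rewrite /fk red_mul red_add !red_sX def_inv mul2n -addnn exprD.
rewrite -{1}[X ^+ (3 ^ k)]mulr1 -mulrDr -[Y in Y + _](expr1n _ (3 ^ k)) -expr_pow3D.
rewrite expnSr mulnC !exprM -!exprMn; congr (_ ^+ _).
transitivity (base * (red (inv1pX 1) * (1 + X))); last by rewrite v1 mulr1.
by rewrite /base; ring.
Qed.

(** * Frobenius equation for the truncated and the full sums *)

Local Notation G s K := (red (Gt s K)).

Lemma red_Gt_nil K : G [::] K = 1. Proof. exact: red_one. Qed.
Lemma red_Gt_cons a s K :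
  G (a :: s) K = \sum_(k < K) base ^+ (3 ^ k * a) * G s k.
Proof.
apply: funext => n; rewrite fps_sumE /red /= rmorph_sum; apply: eq_bigr => k _.
by rewrite exprM -red_fk -red_sexp -red_mul.
Qed.

#[local] Arguments Gt : simpl never.

(* Cubing shifts all the k_j by one; the second term collects the tuples with
   k_r = 0. *)
Lemma Gt_rcons s a K :
  G (rcons s a) K.+1 = G (rcons s a) K ^+ 3 + base ^+ a * G s K ^+ 3.
Proof.
have pow3S k b : base ^+ (3 ^ k.+1 * b) = (base ^+ (3 ^ k * b)) ^+ 3.
  by rewrite -exprM expnSr mulnAC.
elim: s K => [|b s IHs] K /=.
  rewrite !red_Gt_cons big_ord_recl /= mul1n !red_Gt_nil !mulr1 expr1n mulr1 addrC.
  rewrite cube_sum; congr (_ + _); apply: eq_bigr => k _.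
  by rewrite !mulr1 -pow3S.
rewrite red_Gt_cons big_ord_recl /=.
(* With at least two letters, k_1 = 0 leaves no room for k_2. *)
have -> : G (rcons s a) 0 = 0.
  by case: (s) => [|c s1]; rewrite [rcons _ _]/= red_Gt_cons big_ord0.
rewrite mulr0 add0r !red_Gt_cons !cube_sum mulr_sumr -big_split /=.
apply: eq_bigr => k _; rewrite /bump /= add1n pow3S IHs !exprMn; ring.
Qed.

Lemma base_exp_small m i : (i < m)%N -> forall g : A, (base ^+ m * g) i = 0.
Proof. by move=> lt_im g; rewrite /base exprMn -mulrA fps_mulXn_lt. Qed.

Definition positive_word := all (fun a => 0 < a)%N.

(** A term with k >= K is divisible by z^(3^k a), and 3^k a > k since a is positive. *)
Lemma Gt_stable s K L : positive_word s -> (K <= L)%N ->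
  fps_eqm K (G s L) (G s K).
Proof.
case: s => [|a s] pos_s le_KL i lt_iK; first by rewrite !red_Gt_nil.
rewrite !red_Gt_cons -!(big_mkord predT (fun k => base ^+ (3 ^ k * a) * G s k)).
rewrite (@big_cat_nat _ _ _ K) //= fps_addE [Y in _ + Y](_ : _ = 0) ?addr0 //.
rewrite fps_sumE big_nat big1 // => k /andP[le_Kk _]; apply: base_exp_small.
move: pos_s => /= /andP[a_gt0 _].
apply: leq_trans lt_iK (leq_trans le_Kk (leq_trans (ltnW (ltn_expl k _)) _)) => //.
by rewrite leq_pmulr.
Qed.

Lemma Htil_eqm s K : positive_word s -> fps_eqm K (red (Htil s)) (G s K).
Proof.
by move=> pos_s i lt_iK; rewrite (Gt_stable pos_s lt_iK).
Qed.

Lemma Htil_rcons s a : positive_word (rcons s a) ->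
  red (Htil (rcons s a)) = red (Htil (rcons s a)) ^+ 3 + base ^+ a * red (Htil s) ^+ 3.
Proof.
move=> pos_sa; have pos_s : positive_word s.
  by move: pos_sa; rewrite /positive_word all_rcons => /andP[].
apply: funext => n.
have H1 := @Htil_eqm _ n.+1 pos_sa; have H0 := @Htil_eqm _ n.+1 pos_s.
rewrite fps_addE (fps_eqm_exp 3 H1) //.
rewrite (fps_eqm_mul (fun i _ => erefl ((base ^+ a) i)) (fps_eqm_exp 3 H0)) //.
(* Cubing shifts the indices, so the bound is n + 2 here and n + 1 in the cubes; either determines
   the coefficient of z^n. *)
rewrite -fps_addE -Gt_rcons (@Htil_eqm _ n.+2) //.
Qed.

(** * Psi as an inverse square root of 1 + z *)

Definition psi : A := red Psi.
Definition sqrt_1pX : A := (1 + X) * psi.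

(** The factor of index j is 1 modulo z^(3^j), and 3^j > j, so factors with j >= K leave the first K
    coefficients alone. *)
Lemma psi_eqm K : fps_eqm K psi (\prod_(j < K) (1 + X ^+ (3 ^ j))).
Proof.
have stable L M : (M <= L)%N -> fps_eqm M (\prod_(j < L) (1 + X ^+ (3 ^ j)))
    (\prod_(j < M) (1 + X ^+ (3 ^ j))).
  elim: L => [|L IHL]; first by rewrite leqn0 => /eqP ->.
  rewrite leq_eqVlt ltnS => /predU1P[<- //|le_ML] i lt_iM.
  rewrite big_ord_recr /= mulrDr mulr1 fps_addE IHL // mulrC fps_mulXn_lt ?addr0 //.
  by apply: leq_trans lt_iM (leq_trans le_ML (ltnW (ltn_expl L _))).
move=> i lt_iK; rewrite (stable K i.+1) // /psi /red /Psi.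
rewrite -/(red _ i) (big_morph red red_mul red_one).
by congr (_ i); apply: eq_bigr => j _; rewrite red_add red_one red_sX.
Qed.

(** Modulo 3 the factors are (1 + z)^(3^j), and 2(1 + 3 + ... + 3^(K-1)) + 1 = 3^K. *)
Lemma psi_sqr : psi ^+ 2 * (1 + X) = 1.
Proof.
have prod_sqr K : (\prod_(j < K) (1 + X ^+ (3 ^ j))) ^+ 2 * (1 + X) = 1 + X ^+ (3 ^ K).
  elim: K => [|K IHK]; first by rewrite big_ord0 expr1n mul1r expr1.
  rewrite big_ord_recr /= exprMn mulrAC IHK -exprS cubeD expr1n -exprM expnSr //.
apply: funext => n.
rewrite (fps_eqm_mul (fps_eqm_exp 2 (@psi_eqm n.+1)) (fun i _ => erefl ((1 + X) i))) //.
rewrite prod_sqr fps_addE -[X ^+ _]mulr1 fps_mulXn_lt ?addr0 //.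
by apply: ltnW; apply: ltn_expl.
Qed.

Lemma sqrt_1pX_sqr : sqrt_1pX ^+ 2 = 1 + X.
Proof.
transitivity ((1 + X) * (psi ^+ 2 * (1 + X))); last by rewrite psi_sqr mulr1.
by rewrite /sqrt_1pX; ring.
Qed.

Lemma sqrt_1pX_psi : sqrt_1pX * psi = 1.
Proof. by rewrite -[RHS]psi_sqr /sqrt_1pX; ring. Qed.

(** * Polynomials in the square root of 1 + z *)

(** A relation gives q^2 = (1 + z) p^2, where the degrees differ in parity unless p = q = 0. *)
Lemma sqrt_lin_indep (p q : {poly F}) :
  fps_of_poly q + fps_of_poly p * sqrt_1pX = 0 -> p = 0 /\ q = 0.
Proof.
move/eqP; rewrite addr_eq0 => /eqP def_q.
have : fps_of_poly (q ^+ 2) = fps_of_poly (('X + 1) * p ^+ 2).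
  rewrite [RHS]rmorphM !rmorphXn rmorphD rmorph1 /= def_q sqrrN exprMn sqrt_1pX_sqr mulrC.
  by rewrite [1 + _]addrC.
move/fps_of_poly_inj => eq_pq.
have X1_neq0 : 'X + 1 != 0 :> {poly F} by rewrite -size_poly_eq0 -polyC1 size_XaddC.
have [p0|p_neq0] := eqVneq p 0.
  by split=> //; apply/eqP; rewrite -sqrf_eq0 eq_pq p0 expr0n mulr0.
have [q0|q_neq0] := eqVneq q 0.
  move/eqP: eq_pq; rewrite q0 expr0n eq_sym mulf_eq0 sqrf_eq0 (negbTE p_neq0).
  by rewrite orbF (negbTE X1_neq0).
have := congr1 (fun u : {poly F} => size u) eq_pq.
rewrite !expr2 !size_mul ?mulf_neq0 // -polyC1 size_XaddC.
move: p_neq0 q_neq0; rewrite -!size_poly_gt0.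
by move: (size p) (size q) => m n m_gt0 n_gt0; rewrite -[(2%R : nat)]/2%N; lia.
Qed.

Definition eval_sqrt : {rmorphism {poly F} -> A} :=
  horner_morph (fun x => mulrC sqrt_1pX ((@fps_of_poly F \o polyC) x)).

Lemma eval_sqrtX : eval_sqrt 'X = sqrt_1pX. Proof. exact: horner_morphX. Qed.

Lemma eval_sqrt_X2B1 : eval_sqrt ('X^2 - 1) = X.
Proof. by rewrite rmorphB rmorph1 rmorphXn eval_sqrtX sqrt_1pX_sqr addrC addKr. Qed.

Lemma eval_sqrt_comp p : eval_sqrt (p \Po ('X^2 - 1)) = fps_of_poly p.
Proof.
elim/poly_ind: p => [|p c IHp]; first by rewrite comp_poly0 !rmorph0.
rewrite comp_polyD comp_polyM comp_polyX comp_polyC [LHS]rmorphD [in LHS]rmorphM IHp.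
rewrite eval_sqrt_X2B1 [RHS]rmorphD [in RHS]rmorphM.
by congr (_ + _); apply: horner_morphC.
Qed.

(** Even and odd parts write Q(w) as E(w^2) + O(w^2) w; as w^2 = 1 + z, [sqrt_lin_indep] applies. *)
Lemma eval_sqrt_inj : injective eval_sqrt.
Proof.
apply: raddf_inj => Q eQ0; have {eQ0} : eval_sqrt Q = 0 by [].
rewrite -(poly_even_odd Q).
have def_X2 : 'X^2 = ('X + 1) \Po ('X^2 - 1) :> {poly F}.
  by rewrite comp_polyD comp_polyX -polyC1 comp_polyC subrK.
rewrite rmorphD rmorphM eval_sqrtX def_X2 !comp_polyA !eval_sqrt_comp.
by case/sqrt_lin_indep => -> ->; rewrite !comp_poly0 mul0r addr0.
Qed.

Lemma eval_sqrt_base : eval_sqrt 'X^4 * base = eval_sqrt ('X^2 - 1).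
Proof.
by rewrite eval_sqrt_X2B1 rmorphXn eval_sqrtX (exprM sqrt_1pX 2 2) sqrt_1pX_sqr mulrC base_eq.
Qed.

(** * Independence modulo 3 *)

Definition suffixes (t : seq nat) := [seq drop k t | k <- iota 0 (size t).+1].

(* With w = (1 + z)^(1/2), multiplying the relation by w turns the coefficients
   p + q Psi of H_s into the single polynomial w p(w^2 - 1) + q(w^2 - 1). Words
   are reversed so that removing the last letter becomes removing the head. *)
Lemma lin_indep_F3 : lin_indep_over F.
Proof.
move=> I c uI admI rel.
have rel_fps : \sum_(i <- I) fps_of_poly (c i) * red (Defs.family i) = 0.
  by apply: funext => n; rewrite fps_sumE; apply: rel.
pose h t := red (Htil (rev t)).
(* Multiplication by w turns 1 into w, the image of ['X], and Psi into 1. *)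
pose C0 i := (c i \Po ('X^2 - 1)) * (if i.2 then 1 else 'X).
have rel_h : \sum_(i <- I) eval_sqrt (C0 i) * h (rev i.1) = 0.
  transitivity (sqrt_1pX * \sum_(i <- I) fps_of_poly (c i) * red (Defs.family i)); last first.
    by rewrite rel_fps mulr0.
  rewrite mulr_sumr; apply: eq_bigr => -[s b] _.
  rewrite /h revK /C0 rmorphM eval_sqrt_comp /Defs.family /=; case: b.
    by rewrite red_mul -/psi rmorph1 mulr1 [RHS]mulrCA [sqrt_1pX * (_ * _)]mulrA sqrt_1pX_psi mul1r.
  by rewrite eval_sqrtX [RHS]mulrCA mulrA.
(* Suffixes are added to obtain the closed list that [h_lin_indep] requires; those that are not
   words of [I] get coefficient 0. *)
pose S := sort (fun s t => size s <= size t)%N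
  (undup (flatten [seq suffixes (rev i.1) | i <- I])).
have S_mem t : reflect (exists2 i, i \in I & t \in suffixes (rev i.1)) (t \in S).
  rewrite mem_sort mem_undup; apply: (iffP flatten_mapP) => -[i iI ti]; by exists i.
have uS : uniq S by rewrite sort_uniq undup_uniq.
have clS : suffix_closed S.
  move=> a t /S_mem[i iI /mapP[k _ def_t]]; apply/S_mem; exists i => //.
  have lt_k : (k < size (rev i.1))%N.
    by rewrite ltnNge; apply: contra_eqN def_t => /drop_oversize ->.
  apply/mapP; exists k.+1; first by rewrite mem_iota.
  by move: def_t; rewrite (drop_nth 0%N lt_k) => -[].
have goodS : all (all good_letter) S.
  apply/allP => t /S_mem[i iI /mapP[k _ ->]]; apply/allP => a /mem_drop.
  by rewrite mem_rev; have /andP[/allP adm _] := allP admI _ iI => /adm.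
have pwS : pairwise (fun s t => size s <= size t)%N S.
  rewrite -sorted_pairwise ?sort_sorted // => [s t | t s u]; first exact: leq_total.
  exact: leq_trans.
have posS t : all good_letter t -> positive_word (rev t).
  by rewrite /positive_word all_rev; apply: sub_all => a /andP[].
have h_cons a t : all good_letter (a :: t) ->
    h (a :: t) = h (a :: t) ^+ 3 + base ^+ a * h t ^+ 3.
  by move=> /posS; rewrite /h rev_cons; apply: Htil_rcons.
pose C t := \sum_(i <- I | rev i.1 == t) C0 i.
have rel_C : \sum_(t <- S) eval_sqrt (C t) * h t = 0.
  rewrite -[RHS]rel_h.
  under eq_bigr do rewrite /C rmorph_sum mulr_suml.
  rewrite (exchange_big_dep xpredT) //=; apply: eq_big_seq => i iI.
  have iS : rev i.1 \in S.
    by apply/S_mem; exists i => //; apply/mapP; exists 0%N; rewrite ?drop0.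
  rewrite big_mkcond (bigD1_seq _ iS) //= eqxx big1 ?addr0 // => t neq_t.
  by rewrite eq_sym (negbTE neq_t).
have C_eq0 := h_lin_indep eval_sqrt_inj pchar3_fps red_one h_cons eval_sqrt_base uS clS goodS pwS rel_C.
case=> s b sbI.
have /C_eq0 : rev s \in S.
  by apply/S_mem; exists (s, b) => //; apply/mapP; exists 0%N; rewrite ?drop0.
(* A word may occur in [I] with only one of its two indices; the other then gets coefficient 0. *)
pose c' j := if j \in I then c j else 0.
have -> : C (rev s) = (c' (s, false) \Po ('X^2 - 1)) * 'X + (c' (s, true) \Po ('X^2 - 1)).
  transitivity (\sum_(j <- [seq j <- [:: (s, false); (s, true)] | j \in I]) C0 j).
    rewrite /C -big_filter; apply: perm_big; apply: uniq_perm; rewrite ?filter_uniq //.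
      by rewrite /= inE !xpair_eqE andbF.
    move=> [t b']; rewrite !mem_filter !inE !xpair_eqE (can_eq revK) andbC.
    by case: b'; rewrite ?andbT ?andbF ?orbF.
  rewrite big_filter big_mkcond !big_cons big_nil /= addr0 /C0 /c'.
  by do 2!case: ifP => _; rewrite ?comp_poly0 ?mul0r ?mulr1.
(* Evaluated at w, this is p(z) w + q(z) = 0, which separates the two coefficients. *)
move/(congr1 eval_sqrt); rewrite rmorphD rmorphM eval_sqrtX !eval_sqrt_comp rmorph0 addrC.
by case/sqrt_lin_indep; rewrite /c'; case: b sbI => ->.
Qed.
End Mod3.

(** * Lifting from modulo 3 *)

(** For m <= 1 the type ['Z_m] is Z/2Z by convention, hence the bound on m. *)
Lemma intr_Zp_eq0 m (x : int) : (1 < m)%N -> ((x%:~R : 'Z_m) == 0) = (m %| x)%Z.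
Proof.
have natr_eq0 n : (1 < m)%N -> ((n%:R : 'Z_m) == 0) = (m %| n)%N.
  by move=> m_gt1; rewrite -val_eqE /= val_Zp_nat.
case: x => n m_gt1; first exact: natr_eq0.
by rewrite NegzE rmorphN oppr_eq0 [LHS]natr_eq0.
Qed.

Definition combination I (c : seq nat * bool -> {poly int}) n : int :=
  \sum_(i <- I) \sum_(k < n.+1) (c i)`_k * Defs.family i (n - k)%N.

Lemma intr_combination (R : comNzRingType) I (c : seq nat * bool -> {poly int}) n :
  (combination I c n)%:~R = \sum_(i <- I) \sum_(k < n.+1)
    (map_poly intr (c i))`_k * (Defs.family i (n - k)%N)%:~R :> R.
Proof.
rewrite /combination rmorph_sum; apply: eq_bigr => i _; rewrite rmorph_sum.
by apply: eq_bigr => k _; rewrite rmorphM coef_map.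
Qed.

(** Induction on g: dividing the coefficients by 3^g leaves a combination divisible by 3, and
    independence modulo 3 gives one more factor. *)
Lemma combination_dvd g I (c : seq nat * bool -> {poly int}) :
    uniq I -> all admissible I ->
    (forall n, ((3 ^ g)%N %| combination I c n)%Z) ->
  forall i, i \in I -> forall k, ((3 ^ g)%N %| (c i)`_k)%Z.
Proof.
move=> uI admI; elim: g c => [|g IHg] c dvd_c i iI k; first exact: dvd1z.
have dvd_cg j : j \in I -> forall l, ((3 ^ g)%N %| (c j)`_l)%Z.
  apply: IHg => n; apply: dvdz_trans (dvd_c n).
  by rewrite expnSr PoszM dvdz_mulr.
pose d j : {poly int} := map_poly (fun x => x %/ (3 ^ g)%N)%Z (c j).
have coef_d j l : j \in I -> (c j)`_l = (d j)`_l * (3 ^ g)%N.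
  by move=> jI; rewrite coef_map_id0 ?div0z // divzK ?dvd_cg.
have combination_d n : combination I c n = combination I d n * (3 ^ g)%N.
  rewrite mulr_suml; apply: eq_big_seq => j jI; rewrite mulr_suml.
  by apply: eq_bigr => l _; rewrite coef_d // mulrAC.
have pow_neq0 : Posz (3 ^ g) != 0 by rewrite eqz_nat expn_eq0.
rewrite coef_d // expnSr PoszM mulrC dvdz_mul2l //.
rewrite -intr_Zp_eq0 //.
have := @lin_indep_F3 I (fun j => map_poly intr (d j)) uI admI _ i iI.
move=> /(_ _)/polyP/(_ k); rewrite coef_map coef0 => -> //= n.
rewrite -intr_combination; apply/eqP; rewrite (@intr_Zp_eq0 3) //.
by have := dvd_c n; rewrite combination_d expnSr PoszM mulrC dvdz_mul2l.
Qed.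

(** Integer representatives of the coefficients turn a relation into divisibility by 3^g. *)
Lemma lin_indep_Zp g : (0 < g)%N -> lin_indep_over 'Z_(3 ^ g).
Proof.
move=> g_gt0 I c uI admI rel i iI.
have m_gt1 : (1 < 3 ^ g)%N by rewrite -(expn0 3) ltn_exp2l.
pose lift_c j : {poly int} := map_poly (fun x : 'Z_(3 ^ g) => Posz x) (c j).
have lift_cK j : map_poly intr (lift_c j) = c j.
  by apply/polyP => k; rewrite coef_map coef_map_id0 //; apply: natr_Zp.
apply/polyP => k; rewrite -lift_cK coef_map coef0; apply/eqP.
rewrite intr_Zp_eq0 //; apply: (combination_dvd uI) => // n.
rewrite -intr_Zp_eq0 // intr_combination -[X in _ == X](rel n); apply/eqP.
by apply: eq_bigr => j _; rewrite lift_cK.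
Qed.

(** A nonzero coefficient x would be divisible by 3^|x|, which exceeds |x|. *)
Lemma lin_indep_int : lin_indep_over int.
Proof.
move=> I c uI admI rel i iI; apply/polyP => k; rewrite coef0.
set x := (c i)`_k; apply/eqP; rewrite -absz_eq0; apply: contraT; rewrite -lt0n => x_gt0.
have : (Posz (3 ^ `|x|)%N %| x)%Z.
  apply: (combination_dvd uI) => // n.
  suff -> : combination I c n = 0 by exact: dvdz0.
  rewrite -[RHS](rel n); apply: eq_bigr => j _; apply: eq_bigr => l _.
  by rewrite intz.
by move/(dvdn_leq x_gt0); rewrite leqNgt ltn_expl.
Qed.
Local Close Scope ring_scope.

Theorem theorem2p6 :
  lin_indep_over 'Z_3 /\
  (forall gamma : nat, (0 < gamma)%N ->
     lin_indep_over ('Z_(3 ^ gamma))) /\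
  lin_indep_over int.
Proof.
split; first exact: lin_indep_F3.
by split; [exact: lin_indep_Zp | exact: lin_indep_int].
Qed.
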